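(* Let $(Y,\mathcal U)$ be a uniform space, let $f\colon Y\to Y$ be a continuous map with a fixed point $x_0\in Y$, and let $T\colon X\to X$ be a linearization of $f\colon Y\to Y$ on a topological vector space $X$, with associated embedding $j\colon Y\to X$ (so that $j(x_0)=0$). Assume that $j$ is uniformly continuous. Then: \begin{enumerate} \item If $f$ has the targeting property around $x_0$, then $T$ is weakly mixing. \item If $f$ has the strict targeting property around $x_0$, then $T$ is mixing. \end{enumerate}
   Context: An operator on a topological vector space is a continuous linear self-map. Linearization: given a continuous map $f\colon W\to W$ on a topological space $W$ with a fixed point $0_W$ (here $W=Y$, $0_W=x_0$), a continuous injection $j\colon W\to X$ into a topological vector space $X$, and an operator $T\colon X\to X$, one says that $(X,T)$ is a linearization of $(W,f)$ if $T\circ j=j\circ f$, $j(0_W)=0$, and $\operatorname{span}(j(W))$ is dense in $X$. Targeting property: a continuous map $f\colon Y\to Y$ on a uniform space $(Y,\mathcal U)$ with $f(x_0)=x_0$ has the targeting property around $x_0$ if, for every entourage $U\in\mathcal U$ and every finite family $F\subset Y$, there is $n\in\mathbb N$ ($n\ge 1$) such that for every $x,y\in F$: (i) there exist $u,u_0\in Y$ with $\{(u,x),(u_0,x_0),(f^n(u),f^n(u_0))\}\subset U$; and (ii) there exist $v,v_0\in Y$ with $\{(v,v_0),(f^n(v),y),(f^n(v_0),x_0)\}\subset U$. If (for every such $U$ and $F$) the set of $n\in\mathbb N$ satisfying these conditions is co-finite, $f$ has the strict targeting property around $x_0$. $T$ is weakly mixing if $T\times T$ is topologically transitive on $X\times X$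 (a map $S$ is topologically transitive if for all non-empty open $U,V$ there is $n\in\mathbb N$ with $S^n(U)\cap V\neq\emptyset$). $T$ is mixing if for all non-empty open $U,V\subset X$ there is $n_0$ such that $T^n(U)\cap V\neq\emptyset$ for all $n\ge n_0$. *)

(* Defs.v *)
From HB Require Import structures.
From mathcomp Require Import all_boot all_order all_algebra.
From mathcomp Require Import all_classical all_reals all_analysis.

Set Implicit Arguments.
Unset Strict Implicit.
Unset Printing Implicit Defensive.

Import Order.TTheory GRing.Theory Num.Theory.
Import numFieldTopology.Exports.

Local Open Scope classical_set_scope.
Local Open Scope ring_scope.

(* Topological vector spaces are [topologicalLmodType K]: no local convexity
   is assumed ([tvsType] would add it), and no separation axiom. The set of
   natural numbers indexing iterates is {1, 2, ...} throughout. *)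

Section TopologicalVectorSpaces.
Context {K : numFieldType} {X : topologicalLmodType K}.

Definition linear_span (A : set X) : set X :=
  [set x | exists (n : nat) (a : 'I_n -> K) (v : 'I_n -> X),
    (forall i, A (v i)) /\ x = \sum_(i < n) a i *: v i].

(* The canonical translation-invariant uniformity of a topological vector
   space. [UniformLmodule] is not usable here: it requires scaling to be
   jointly uniformly continuous, which fails in every normed space but 0. *)
Definition tvs_entourage : set_system (X * X) :=
  [set E | exists2 N : set X, nbhs 0 N &
    [set p : X * X | N (p.1 - p.2)] `<=` E].

(* Same shape as the library's [unif_continuous], with [tvs_entourage] on the
   codomain. *)
Definition unif_continuous_to_tvs (Y : uniformType) (j : Y -> X) : Prop :=
  (fun p : Y * Y => (j p.1, j p.2)) @ entourage --> tvs_entourage.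

End TopologicalVectorSpaces.

Record is_linearization (K : numFieldType) (W : topologicalType) (f : W -> W)
    (w0 : W) (X : topologicalLmodType K) (j : W -> X) (T : {linear X -> X})
    : Prop := IsLinearization {
  linearization_op_continuous : continuous T ;
  linearization_emb_continuous : continuous j ;
  linearization_emb_injective : injective j ;
  linearization_comm : T \o j = j \o f ;
  linearization_emb0 : j w0 = 0 ;
  linearization_dense : dense (linear_span (range j)) }.

Section Targeting.
Context {Y : uniformType}.

Definition targets_at (f : Y -> Y) (x0 : Y) (U : set (Y * Y)) (F : set Y)
    (n : nat) : Prop :=
  forall x y, F x -> F y ->
    (exists u u0, [/\ U (u, x), U (u0, x0) & U (iter n f u, iter n f u0)]) /\
    (exists v v0, [/\ U (v, v0), U (iter n f v, y) & U (iter n f v0, x0)]).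

Definition targeting (f : Y -> Y) (x0 : Y) : Prop :=
  forall (U : set (Y * Y)) (F : set Y), entourage U -> finite_set F ->
    exists2 n : nat, (0 < n)%N & targets_at f x0 U F n.

Definition strict_targeting (f : Y -> Y) (x0 : Y) : Prop :=
  forall (U : set (Y * Y)) (F : set Y), entourage U -> finite_set F ->
    finite_set [set n : nat | (0 < n)%N /\ ~ targets_at f x0 U F n].

End Targeting.

Definition topologically_transitive (Z : topologicalType) (S : Z -> Z) : Prop :=
  forall U V : set Z, open U -> open V -> U !=set0 -> V !=set0 ->
    exists2 n : nat, (0 < n)%N & (iter n S @` U) `&` V !=set0.

Definition weakly_mixing (Z : topologicalType) (S : Z -> Z) : Prop :=
  topologically_transitive (fun p : Z * Z => (S p.1, S p.2)).

Definition mixing (Z : topologicalType) (S : Z -> Z) : Prop :=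
  forall U V : set Z, open U -> open V -> U !=set0 -> V !=set0 ->
    exists n0 : nat, forall n, (n0 <= n)%N -> (iter n S @` U) `&` V !=set0.

(* Main.v *)
Require Import Defs.
From HB Require Import structures.
From mathcomp Require Import all_boot all_order all_algebra.
From mathcomp Require Import all_classical all_reals all_analysis.

Set Implicit Arguments.
Unset Strict Implicit.
Unset Printing Implicit Defensive.

Import Order.TTheory GRing.Theory Num.Theory.
Import numFieldTopology.Exports.

Local Open Scope classical_set_scope.
Local Open Scope ring_scope.

(** The sets of times [n] at which [f] targets, over all entourages and finite
    sets, generate a filter [G] on the naturals. Say that [p] reaches [q] when,
    for [G]-almost all [n], some point near [p] is sent near [q] by [T^n]. This
    relation is linear in [(p, q)] and closed. Condition (i) makes every [j x]
    reach [0], via [j u - j u0], and condition (ii) makes [0] reach every [j y],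
    via [j v - j v0]; hence, by linearity and density, every point reaches every
    point. Targeting says that [G] is proper, and strict targeting that [G] is
    coarser than the cofinite filter. *)

Section Reach.
Context {K : numFieldType} {X : topologicalLmodType K}.
Implicit Types (T : {linear X -> X}) (p q : X).

Lemma iter_linearP T n a x y :
  iter n T (a *: x + y) = a *: iter n T x + iter n T y.
Proof. by elim: n => //= n ->; rewrite linearP. Qed.

Lemma scale_add_continuous (a : K) :
  continuous (fun z : X * X => a *: z.1 + z.2).
Proof.
move=> z; pose h (z : X * X) := (a *: z.1, z.2).
apply: (@continuous_comp _ _ _ h (fun z : X * X => z.1 + z.2)); last first.
  exact: add_continuous.
apply: cvg_pair => /=; last exact: cvg_snd.
pose g (z : X * X) := (a : K^o, z.1).
apply: (@continuous_comp _ _ _ g (fun z : K^o * X => z.1 *: z.2)); last first.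
  exact: scale_continuous.
by apply: (@cvg_pair _ _ _ _ (nbhs (a : K^o)) (nbhs z.1)) => /=;
  [exact: cvg_cst|exact: cvg_fst].
Qed.

(** Combines continuity of addition at [(z, 0)] with continuity of subtraction at [(0, 0)]. A single
    [B] thus absorbs the two independent errors made when a pair of points of [Y] is
    approximated. *)
Lemma nbhs_addB (z : X) (N : set X) : nbhs z N ->
  exists2 B : set X, nbhs 0 B & forall a b, B a -> B b -> N (z + (a - b)).
Proof.
rewrite -{1}[z]addr0 => zN.
have [[N1 N2] /= [zN1 N20] sN] := @add_continuous X (z, 0) _ zN.
rewrite -(subr0 (0 : X)) in N20.
have [[B1 B2] /= [B10 B20] sB] := @sub_continuous X (0, 0) _ N20.
exists (B1 `&` B2); first exact: filterI.
move=> a b [Ba _] [_ Bb]; apply: (sN (z, a - b)); split => /=.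
  exact: nbhs_singleton zN1.
exact: (sB (a, b)).
Qed.

Lemma linear_span_closed (P : X -> Prop) (A : set X) : P 0 ->
  (forall a x y, P x -> P y -> P (a *: x + y)) ->
  (forall x, A x -> P x) -> forall x, linear_span A x -> P x.
Proof.
move=> P0 PZD AP _ [n [a [v [Av ->]]]].
elim/big_ind: _ => // [x y Px Py|i _].
  by rewrite -[x]scale1r; exact: PZD.
by rewrite -[X in P X]addr0; apply: PZD => //; exact: AP.
Qed.

(** The witness [w] may depend on [n]: for the cofinite filter this is membership of [q] in the
    mixing extended limit set of [p]. *)
Definition reaches T (G : set_system nat) p q : Prop :=
  forall N M : set X, nbhs p N -> nbhs q M ->
    \forall n \near G, exists2 w, N w & M (iter n T w).

Context (T : {linear X -> X}) (G : set_system nat) {FG : Filter G}.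

(** [G] is stable under intersection, so both pairs can be served at the same times [n], and the two
    witnesses are then combined linearly. *)
Lemma reaches_linear a p q p' q' : reaches T G p q -> reaches T G p' q' ->
  reaches T G (a *: p + p') (a *: q + q').
Proof.
move=> pq pq' N M pN qM.
have [[N1 N2]/= [pN1 pN2] sN] := @scale_add_continuous a (p, p') _ pN.
have [[M1 M2] /= [qM1 qM2] sM] := @scale_add_continuous a (q, q') _ qM.
apply: filterS2 (pq _ _ pN1 qM1) (pq' _ _ pN2 qM2).
move=> n [w Nw Mw] [w' Nw' Mw']; exists (a *: w + w').
  exact: (sN (w, w')).
by rewrite iter_linearP; exact: (sM (iter n T w, iter n T w')).
Qed.

Lemma reaches00 : reaches T G 0 0.
Proof.
move=> N M N0 M0; apply: filterE => n; exists 0; first exact: nbhs_singleton.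
have -> : iter n T 0 = 0 by elim: n => //= n ->; rewrite linear0.
exact: nbhs_singleton.
Qed.

Lemma reaches_span (A : set X) : (forall x, A x -> reaches T G x 0) ->
  (forall x, A x -> reaches T G 0 x) ->
  forall p q, linear_span A p -> linear_span A q -> reaches T G p q.
Proof.
move=> A1 A2 p q Ap Aq.
have p0 : reaches T G p 0.
  apply: linear_span_closed A1 _ Ap; first exact: reaches00.
  by move=> a x y x0 /(reaches_linear (a:=a) x0); rewrite scaler0 addr0.
have q0 : reaches T G 0 q.
  apply: linear_span_closed A2 _ Aq; first exact: reaches00.
  by move=> a x y x0 /(reaches_linear (a:=a) x0); rewrite scaler0 addr0.
(* The pair [(p, q)] is the sum of [(p, 0)] and [(0, q)]. *)
by have := reaches_linear (a:=1) p0 q0; rewrite !scale1r addr0 add0r.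
Qed.

(** An open set around [p] is also a neighbourhood of each point of [D] that it contains, so [p] and
    [q] can be replaced by such points. *)
Lemma reaches_dense (D : set X) : dense D ->
  (forall p q, D p -> D q -> reaches T G p q) -> forall p q, reaches T G p q.
Proof.
move=> dD DD p q N M pN qM.
have approx (x : X) (B : set X) : nbhs x B -> exists2 y, D y & nbhs y B.
  rewrite nbhsE => -[C [oC Cx] CB].
  have [|y [Cy Dy]] := dD C _ oC; first by exists x.
  by exists y => //; rewrite nbhsE; exists C.
have [p' Dp' p'N] := approx _ _ pN; have [q' Dq' q'M] := approx _ _ qM.
exact: (DD p' q').
Qed.

(** Each coordinate has its own set of good times in [G]; their intersection is again in [G], and
    properness supplies a common time. *)
Lemma reaches_weakly_mixing : ProperFilter G ->
  (\forall n \near G, (0 < n)%N) ->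
  (forall p q, reaches T G p q) -> weakly_mixing T.
Proof.
move=> PG Gpos all_reach U V oU oV [p Up] [q Vq].
have [[N1 N2]/= [pN1 pN2] sN] : nbhs p U by exact: open_nbhs_nbhs.
have [[M1 M2] /= [qM1 qM2] sM] : nbhs q V by exact: open_nbhs_nbhs.
have [n [[n0 [w1 Nw1 Mw1]] [w2 Nw2 Mw2]]] := filter_ex (filterI
  (filterI Gpos (all_reach _ _ _ _ pN1 qM1)) (all_reach _ _ _ _ pN2 qM2)).
exists n => //; exists (iter n T w1, iter n T w2); split; last exact: sM.
exists (w1, w2); first exact: sN.
by elim: {n0 Mw1 Mw2} n => //= n ->.
Qed.

Lemma reaches_mixing : G `<=` \oo ->
  (forall p q, reaches T G p q) -> mixing T.
Proof.
move=> Goo all_reach U V oU oV [p Up] [q Vq].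
have pU : nbhs p U by exact: open_nbhs_nbhs.
have qV : nbhs q V by exact: open_nbhs_nbhs.
have [n0 _ H] := Goo _ (all_reach _ _ _ _ pU qV).
exists n0 => n /H [w Uw Vw].
by exists (iter n T w); split=> //; exists w.
Qed.

End Reach.

Section TargetingFilter.
Context {Y : uniformType} (f : Y -> Y) (x0 : Y).

(** The guard [0 < n] is built in because [targets_at] may hold at time 0, which does not count as
    an iterate. *)
Definition targeting_filter : set_system nat :=
  [set A | exists U F, [/\ entourage U, finite_set F &
     forall n, (0 < n)%N -> targets_at f x0 U F n -> A n]].

(** Shrinking the entourage or enlarging the family only removes times, so the generating sets form
    a filter base. *)
Lemma targets_atS (U V : set (Y * Y)) (F H : set Y) n : U `<=` V -> H `<=` F ->
  targets_at f x0 U F n -> targets_at f x0 V H n.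
Proof.
move=> UV HF t x y /HF Fx /HF Fy.
have [[u [u0 [? ? ?]]] [v [v0 [? ? ?]]]] := t x y Fx Fy.
by split; [exists u, u0|exists v, v0]; split; exact: UV.
Qed.

Global Instance targeting_filter_filter : Filter targeting_filter.
Proof.
split.
- by exists setT, set0; split=> //; exact: entourageT.
- move=> A B [U [F [eU fF UA]]] [V [H [eV fH VB]]].
  exists (U `&` V), (F `|` H); split; first exact: filterI.
    by rewrite finite_setU.
  move=> n n0 t; split; [apply: UA => //|apply: VB => //];
    apply: targets_atS t; [exact: subIsetl|exact: subsetUl|
                           exact: subIsetr|exact: subsetUr].
- move=> A B AB [U [F [eU fF UA]]]; exists U, F; split=> // n n0 t.
  exact/AB/UA.
Qed.

Lemma targeting_filter_gt0 : \forall n \near targeting_filter, (0 < n)%N.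
Proof. by exists setT, set0; split=> //; exact: entourageT. Qed.

Lemma targeting_filter_proper :
  targeting f x0 -> ProperFilter targeting_filter.
Proof.
move=> tf; split; last exact: targeting_filter_filter.
by move=> [U [F [eU fF no]]]; have [n n0 /(no n n0)] := tf U F eU fF.
Qed.

Lemma finite_set_nat_near (A : set nat) : finite_set A ->
  \forall n \near \oo, ~ A n.
Proof.
move=> /finite_seqP[s ->]; exists (\max_(i <- s) i).+1 => // n /= ltn sn.
by have := leq_trans ltn (@leq_bigmax_seq _ s xpredT id n sn isT); rewrite ltnn.
Qed.

Lemma targeting_filter_oo :
  strict_targeting f x0 -> targeting_filter `<=` \oo.
Proof.
move=> tf A [U [F [eU fF UA]]].
(* Strict targeting bounds the failures among positive times only, hence time 0 is discarded
   separately. *)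
have := finite_set_nat_near (tf U F eU fF); have := nbhs_infty_gt 0.
apply: filterS2 => n n0 /not_andP[//|/contrapT t]; exact: UA.
Qed.

End TargetingFilter.

Section Linearization.
Context {K : numFieldType} {Y : uniformType} (f : Y -> Y) (x0 : Y).
Context {X : topologicalLmodType K} (j : Y -> X) (T : {linear X -> X}).
Hypothesis (lin : is_linearization f x0 j T).
Hypothesis j_unif : unif_continuous_to_tvs j.

Lemma linearization_iter n y : iter n T (j y) = j (iter n f y).
Proof.
elim: n => //= n ->.
exact: (congr1 (fun g => g (iter n f y)) (linearization_comm lin)).
Qed.

Lemma unif_tvs_entourage (N : set X) : nbhs 0 N ->
  entourage [set p : Y * Y | N (j p.1 - j p.2)].
Proof.
move=> N0.
have /j_unif : tvs_entourage [set p : X * X | N (p.1 - p.2)] by exists N.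
exact.
Qed.

Lemma reaches_emb0 x : reaches T (targeting_filter f x0) (j x) 0.
Proof.
move=> N M xN M0; have [B B0 BN] := nbhs_addB xN.
(* One entourage controls both the errors at time 0, through [B], and the closeness at time [n],
   through [M]. *)
exists [set p | (B `&` M) (j p.1 - j p.2)], [set x]; split.
- by apply: unif_tvs_entourage; exact: filterI.
- exact: finite_set1.
move=> n _ /(_ x x erefl erefl)[[u [u0 [[ux _] [u0x0 _] [_ uu0]]]] _].
(* As [j x0 = 0], this witness equals [j x + ((j u - j x) - (j u0 - j x0))], with both inner
   differences in [B]. *)
exists (j u - j u0).
  move: (BN _ _ ux u0x0); rewrite /= (linearization_emb0 lin) subr0.
  by rewrite addrA [j x + _]addrC subrK.
rewrite addrC -scaleN1r iter_linearP scaleN1r !linearization_iter.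
by rewrite addrC.
Qed.

(** The roles of the two times are exchanged: [j v - j v0] is small at the start, and the errors
    absorbed by [B] are those of [iter n f v] against [y] and of [iter n f v0] against [x0]. *)
Lemma reaches_0emb y : reaches T (targeting_filter f x0) 0 (j y).
Proof.
move=> N M N0 yM; have [B B0 BM] := nbhs_addB yM.
exists [set p | (B `&` N) (j p.1 - j p.2)], [set y]; split.
- by apply: unif_tvs_entourage; exact: filterI.
- exact: finite_set1.
move=> n _ /(_ y y erefl erefl)[_ [v [v0 [[_ vv0] [vy _] [v0x0 _]]]]].
exists (j v - j v0) => //.
rewrite addrC -scaleN1r iter_linearP scaleN1r !linearization_iter.
move: (BM _ _ vy v0x0); rewrite /= (linearization_emb0 lin) subr0.
by rewrite addrA [j y + _]addrC subrK addrC.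
Qed.

Lemma linearization_reaches p q : reaches T (targeting_filter f x0) p q.
Proof.
apply: reaches_dense (linearization_dense lin) _ p q.
apply: reaches_span => _ [y _ <-]; [exact: reaches_emb0|exact: reaches_0emb].
Qed.

End Linearization.

Theorem theorem4p5 (K : numFieldType) (Y : uniformType) (f : Y -> Y) (x0 : Y)
    (X : topologicalLmodType K) (j : Y -> X) (T : {linear X -> X})
    (f_cont : continuous f) (f_x0 : f x0 = x0)
    (lin : is_linearization f x0 j T) (j_unif : unif_continuous_to_tvs j) :
  (targeting f x0 -> weakly_mixing T) /\
  (strict_targeting f x0 -> mixing T).
Proof.
have all_reach := linearization_reaches lin j_unif.
split=> tf.
  apply: reaches_weakly_mixing all_reach; last exact: targeting_filter_gt0.
  exact: targeting_filter_proper.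
by apply: reaches_mixing all_reach; exact: targeting_filter_oo.
Qed.
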